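(* Let $p,q$ be prime numbers with $q-p=2$, and for $\sigma\in\{1,-1\}$ consider the simultaneous Pellian equations in integers $x,y,z$: $$\text{(III)}\quad x^2-py^2=\sigma,\qquad z^2-qy^2=\sigma.$$ (a) If $p\equiv 5\pmod 8$, then (III) has no nontrivial integer solution (for either $\sigma=1$ or $\sigma=-1$). (b) If $p\equiv 3$ or $5\pmod 8$, then (III) with $\sigma=-1$ has no nontrivial integer solution.
   Context: An integer solution $(x,y,z)$ of (III) is called nontrivial if $y\neq 0$. *)

(* Defs.v *)
From mathcomp Require Import all_boot all_order all_algebra.

Set Implicit Arguments.
Unset Strict Implicit.
Unset Printing Implicit Defensive.

Import GRing.Theory.
Local Open Scope ring_scope.

Definition pellian_system (p q : nat) (sigma x y z : int) : Prop :=
  x ^+ 2 - p%:Z * y ^+ 2 = sigma /\ z ^+ 2 - q%:Z * y ^+ 2 = sigma.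

Definition has_nontrivial_solution (p q : nat) (sigma : int) : Prop :=
  exists x y z : int, pellian_system p q sigma x y z /\ y <> 0.

(* Main.v *)
Require Import Defs.
From mathcomp Require Import all_boot all_order all_algebra.
From mathcomp Require Import zify ring.
Import Num.Theory.

(** Write the system over the natural numbers.

    For sigma = -1 it suffices to reduce modulo 4: one of p, q is congruent to
    3, say r, and x^2 + 1 = r y^2 would make x^2 + y^2 congruent to 3
    ([no_negative_pell]).

    For sigma = 1 and p = 5 modulo 8, Fermat descent applies to the homogeneous
    system
      x^2 = w^2 + p y^2,  z^2 = w^2 + q y^2,  w and y coprime,  y > 0,
    of which the given one is the case w = 1.  Modulo 8, w is odd and 4 divides
    y; put y = 2v.  In (x-w)/2 * (x+w)/2 = p v^2 the factors on the left are
    coprime, so they are a^2 and p b^2 in some order, with v = ab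
    ([pell_factor]); likewise (z-w)/2 and (z+w)/2 are c^2 and q d^2 with
    v = cd.  Hence w = |a^2 - p b^2| = |c^2 - q d^2|.

    If the two differences have opposite signs, a^2 + c^2 = p b^2 + q d^2,
    which together with ab = cd even is impossible modulo 8
    ([opposite_signs_mod8]).  If they have the same sign, write a = rs, c = rt,
    b = tu, d = su, which is possible because ab = cd.  The equation
    a^2 + q d^2 = c^2 + p b^2 becomes
      s^2 (r^2 + q u^2) = t^2 (r^2 + p u^2),
    and as s and t are coprime, r^2 + p u^2 = k s^2 and r^2 + q u^2 = k t^2
    for some k.  This k divides 2 r^2 and 2 u^2 because q - p = 2, so k is 1
    or 2; modulo 8 the value 2 is excluded.  Thus k = 1, and (s, t, r, u) is a
    solution of the homogeneous system in which u <= v < y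
    ([same_sign_descent]). *)

Set Implicit Arguments.
Unset Strict Implicit.
Unset Printing Implicit Defensive.

(** * Residues of squares *)

(** The residue of [x ^ 2] modulo 8 determines the 2-adic valuation of [x] as
    far as it is 0, 1 or at least 2.  The quotients are exposed so that
    congruences between such squares become linear arithmetic. *)
Lemma sqrn_mod8 (x : nat) : exists h k,
  [\/ x = 4 * h /\ x ^ 2 = 8 * k,
      x = 2 * h + 1 /\ x ^ 2 = 8 * k + 1
    | x = 4 * h + 2 /\ x ^ 2 = 8 * k + 4].
Proof.
have : x %% 4 < 4 by rewrite ltn_mod.
have := divn_eq x 4; move: (x %/ 4) (x %% 4) => h [|[|[|[|//]]]] -> _.
- by exists h, (2 * h ^ 2); apply: Or31; lia.
- by exists (2 * h), (2 * h ^ 2 + h); apply: Or32; lia.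
- by exists h, (2 * h ^ 2 + 2 * h); apply: Or33; lia.
- by exists (2 * h + 1), (2 * h ^ 2 + 3 * h + 1); apply: Or32; lia.
Qed.

Lemma coprime_odd (m n : nat) : coprime m n -> odd m || odd n.
Proof.
move=> cmn; apply: contraLR (cmn); rewrite negb_or -!dvdn2 => /andP[dm dn].
apply/negP => /eqP g1; have : 2 %| gcdn m n by rewrite dvdn_gcd dm dn.
by rewrite g1.
Qed.

Lemma no_negative_pell (r x y : nat) : r %% 4 = 3 -> x ^ 2 + 1 <> r * y ^ 2.
Proof.
move=> r3; have := divn_eq r 4; rewrite r3 => ->.
have [h [k Hx]] := sqrn_mod8 x; have [i [j Hy]] := sqrn_mod8 y.
by case: Hx => -[_ ->]; case: Hy => -[_ ->]; lia.
Qed.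

(** If [w] and [y] were both odd, [x ^ 2] would be 6 modulo 8; if only [y] were
    odd, [z ^ 2] would be 3 modulo 4.  So [y] is even and the other three are
    odd; then 8 divides [5 * y ^ 2], which forces 4 to divide [y]. *)
Lemma homogeneous_parity (p x z w y : nat) :
  p %% 8 = 5 -> coprime w y -> x ^ 2 = w ^ 2 + p * y ^ 2 ->
  z ^ 2 = w ^ 2 + (p + 2) * y ^ 2 ->
  [/\ 4 %| y, odd w, odd x & odd z].
Proof.
move=> p5 /coprime_odd; have := divn_eq p 8; rewrite p5 => ->.
have [h [k Hw]] := sqrn_mod8 w; have [i [j Hy]] := sqrn_mod8 y.
have [h1 [k1 Hx]] := sqrn_mod8 x; have [i1 [j1 Hz]] := sqrn_mod8 z.
case: Hw => -[-> ->]; case: Hy => -[-> ->] odd_wy;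
  case: Hx => -[-> ->] Ex; case: Hz => -[-> ->] Ez; first [split; lia | lia].
Qed.

(** Modulo 8 the equation would say [c ^ 2 + d ^ 2 = 5 * b ^ 2 - a ^ 2].  Exactly
    one of [c], [d] is odd, so already modulo 4 [a] is the even one of [a], [b].
    If 4 divides [a], then [c ^ 2 + d ^ 2] is 5 and 4 does not divide [c * d];
    otherwise it is 1 and 4 divides [c * d].  Both contradict [a * b = c * d]. *)
Lemma opposite_signs_mod8 (p a b c d : nat) :
  p %% 8 = 5 -> coprime a b -> coprime c d -> a * b = c * d ->
  ~~ odd (a * b) -> a ^ 2 + c ^ 2 <> p * b ^ 2 + (p + 2) * d ^ 2.
Proof.
move=> p5 /coprime_odd + /coprime_odd; have := divn_eq p 8; rewrite p5 => ->.
have [h [k Ha]] := sqrn_mod8 a; have [i [j Hb]] := sqrn_mod8 b.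
have [h1 [k1 Hc]] := sqrn_mod8 c; have [i1 [j1 Hd]] := sqrn_mod8 d.
case: Ha => -[-> ->]; case: Hb => -[-> ->] odd_ab;
  case: Hc => -[-> ->]; case: Hd => -[-> ->] odd_cd; lia.
Qed.

(** Coprime [r] and [u] would both have to be odd, which makes the left side 6
    modulo 8 and hence [s ^ 2] 3 modulo 4. *)
Lemma double_square_mod8 (p r u s : nat) :
  p %% 8 = 5 -> coprime r u -> r ^ 2 + p * u ^ 2 <> s ^ 2 * 2.
Proof.
move=> p5 /coprime_odd; have := divn_eq p 8; rewrite p5 => ->.
have [h [k Hr]] := sqrn_mod8 r; have [i [j Hu]] := sqrn_mod8 u.
have [h1 [k1 Hs]] := sqrn_mod8 s.
by case: Hr => -[-> ->]; case: Hu => -[-> ->] odd_ru;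
  case: Hs => -[-> ->]; lia.
Qed.

(** * Factorizations *)

(** With [g] the gcd of [m] and [v], say [m = g m'] and [v = g v'], the equation
    becomes [m' n = g v' ^ 2].  Here [m'] is coprime to [v'] and [g] to [n], so
    [m'] and [g] divide each other. *)
Lemma coprime_mul_square (m n v : nat) :
  0 < m -> coprime m n -> m * n = v ^ 2 -> m = gcdn m v ^ 2.
Proof.
move=> m_gt0 cmn e; set g := gcdn m v.
have g_gt0 : 0 < g by rewrite gcdn_gt0 m_gt0.
have [m' Em] : exists m', m = m' * g by apply/dvdnP; exact: dvdn_gcdl.
have [v' Ev] : exists v', v = v' * g by apply/dvdnP; exact: dvdn_gcdr.
have cmv : coprime m' v'.
  rewrite /coprime -(eqn_pmul2r g_gt0) mul1n.
  by rewrite muln_gcdl -Em -Ev eqxx.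
have e' : m' * n = g * v' ^ 2.
  apply/eqP; rewrite -(eqn_pmul2r g_gt0); apply/eqP.
  by rewrite mulnAC -Em e Ev; ring.
suff gm : g = m' by rewrite {1}Em -gm mulnn.
have cgn : coprime g n by apply: coprime_dvdl cmn; exact: dvdn_gcdl.
apply/eqP; rewrite eqn_dvd -(Gauss_dvdl m' cgn) e' dvdn_mulr //=.
by rewrite -(Gauss_dvdl g (coprimeXr 2 cmv)) -e' dvdn_mulr.
Qed.

Lemma prime_mul_square (p m n v : nat) :
  prime p -> 0 < m -> 0 < n -> coprime m n -> m * n = p * v ^ 2 ->
  exists a b, v = a * b /\
    (m = a ^ 2 /\ n = p * b ^ 2 \/ m = p * b ^ 2 /\ n = a ^ 2).
Proof.
move=> pr_p; wlog : m n / p %| n => [IH m_gt0 n_gt0 cmn e|].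
  have : p %| m * n by rewrite e dvdn_mulr.
  rewrite Euclid_dvdM // => /orP[pm|pn]; last exact: IH.
  rewrite coprime_sym in cmn; rewrite mulnC in e.
  have [a [b [-> E]]] := IH n m pm n_gt0 m_gt0 cmn e.
  by exists a, b; split=> //; case: E => -[? ?]; [right | left].
move=> /dvdnP[n' ->] m_gt0; rewrite muln_gt0 coprimeMr.
move=> /andP[n'_gt0 p_gt0] /andP[cmn _] e.
have {}e : m * n' = v ^ 2.
  by apply/eqP; rewrite -(eqn_pmul2l p_gt0) -e; apply/eqP; ring.
have Em := coprime_mul_square m_gt0 cmn e.
rewrite mulnC coprime_sym in e cmn.
have En := coprime_mul_square n'_gt0 cmn e.
exists (gcdn m v), (gcdn n' v); split; last by left; split=> //; rewrite mulnC -En.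
by apply/eqP; rewrite -eqn_sqr expnMn -Em -En mulnC e.
Qed.

(** The two factors of [(x - w) / 2 * ((x + w) / 2) = p * v ^ 2] differ by [w].
    Their gcd [g] therefore divides [w] and is coprime to [v], so [g ^ 2], which
    divides [p * v ^ 2], divides the prime [p]. *)
Lemma pell_factor (p x w v : nat) :
  prime p -> odd w -> odd x -> coprime w v -> 0 < v ->
  x ^ 2 = w ^ 2 + p * (2 * v) ^ 2 ->
  exists a b, [/\ v = a * b, coprime a b &
    w + a ^ 2 = p * b ^ 2 \/ w + p * b ^ 2 = a ^ 2].
Proof.
move=> pr_p odd_w odd_x cwv v_gt0 e; have p_gt0 := prime_gt0 pr_p.
have ltwx : w < x by rewrite -ltn_sqr e -[ltnLHS]addn0 ltn_add2l !muln_gt0 p_gt0 v_gt0.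
have [m Ex] : exists m, x = 2 * m + w by exists ((x - w) %/ 2); lia.
have {}e : m * (w + m) = p * v ^ 2 by move: e; rewrite Ex; lia.
have m_gt0 : 0 < m by lia.
have cmn : coprime m (w + m).
  rewrite /coprime gcdnDr; set g := gcdn m w.
  have gw : g %| w := dvdn_gcdr m w.
  have gm : g %| m := dvdn_gcdl m w.
  have : g ^ 2 %| p * v ^ 2 by rewrite -e -mulnn dvdn_mul ?dvdn_add.
  rewrite Gauss_dvdl; last by rewrite coprimeXl ?coprimeXr ?(coprime_dvdl gw).
  move=> gp; have /(primeP pr_p).2 : g %| p by apply: dvdn_trans gp; exact: dvdn_mulr.
  case/orP=> // /eqP gE; move: gp; rewrite gE => /(dvdn_leq p_gt0).
  by have := prime_gt1 pr_p; nia.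
have n_gt0 : 0 < w + m by lia.
have [a [b [vE E]]] := prime_mul_square pr_p m_gt0 n_gt0 cmn e.
exists a, b; split=> //; last by case: E; lia.
case: E cmn => -[-> ->]; last rewrite coprime_sym;
  by rewrite coprimeMr !coprime_pexpl ?coprime_pexpr // => /andP[].
Qed.

(** * The descent *)

(** Take [r = gcdn a c]; the cofactors of [a] and [c] are coprime, so they can
    be cancelled across the equation. *)
Lemma four_number (a b c d : nat) :
  0 < a -> 0 < c -> a * b = c * d ->
  exists r s t u,
    [/\ a = r * s, c = r * t, b = t * u, d = s * u & coprime s t].
Proof.
move=> a_gt0 c_gt0 e; set r := gcdn a c.
have r_gt0 : 0 < r by rewrite gcdn_gt0 a_gt0.
have [s Ea] : exists s, a = s * r by apply/dvdnP; exact: dvdn_gcdl.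
have [t Ec] : exists t, c = t * r by apply/dvdnP; exact: dvdn_gcdr.
have cst : coprime s t.
  by rewrite /coprime -(eqn_pmul2r r_gt0) mul1n muln_gcdl -Ea -Ec eqxx.
have {}e : s * b = t * d.
  apply/eqP; rewrite -(eqn_pmul2r r_gt0); apply/eqP.
  by rewrite mulnAC -Ea e Ec; ring.
have /dvdnP[u Eb] : t %| b.
  by rewrite -(Gauss_dvdr b (_ : coprime t s)) 1?coprime_sym // e dvdn_mulr.
have t_gt0 : 0 < t by move: c_gt0; rewrite Ec muln_gt0 => /andP[].
exists r, s, t, u; split=> //; rewrite 1?mulnC //.
by apply/eqP; rewrite -(eqn_pmul2l t_gt0) -e Eb; apply/eqP; ring.
Qed.

(** The quotient [k] of [r ^ 2 + p * u ^ 2] by [s ^ 2] is also that of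
    [r ^ 2 + (p + 2) * u ^ 2] by [t ^ 2].  It divides [2 * u ^ 2], the difference
    of the two forms, and [2 * r ^ 2], which is [p + 2] times the first minus
    [p] times the second; so it divides 2. *)
Lemma same_sign_descent (p a b c d : nat) :
  p %% 8 = 5 -> 0 < a -> 0 < b -> 0 < c -> coprime a b -> a * b = c * d ->
  a ^ 2 + (p + 2) * d ^ 2 = c ^ 2 + p * b ^ 2 ->
  exists r s t u, [/\ 0 < u <= b, coprime r u,
    s ^ 2 = r ^ 2 + p * u ^ 2 & t ^ 2 = r ^ 2 + (p + 2) * u ^ 2].
Proof.
move=> p5 a_gt0 b_gt0 c_gt0 cab abcd e.
have [r [s [t [u [Ea Ec Eb Ed cst]]]]] := four_number a_gt0 c_gt0 abcd.
have {abcd}cru : coprime r u.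
  by move: cab; rewrite Ea Eb coprimeMl !coprimeMr => /andP[/andP[]].
move: a_gt0 b_gt0; rewrite Ea Eb !muln_gt0 => /andP[r_gt0 s_gt0] /andP[t_gt0 u_gt0].
have {e}E : s ^ 2 * (r ^ 2 + (p + 2) * u ^ 2) = t ^ 2 * (r ^ 2 + p * u ^ 2).
  have -> : s ^ 2 * (r ^ 2 + (p + 2) * u ^ 2) =
            (r * s) ^ 2 + (p + 2) * (s * u) ^ 2 by ring.
  by rewrite -Ea -Ed e Ec Eb; ring.
have cst2 : coprime (s ^ 2) (t ^ 2) by rewrite coprimeXl ?coprimeXr.
have /dvdnP[k Es] : s ^ 2 %| r ^ 2 + p * u ^ 2.
  by rewrite -(Gauss_dvdr _ cst2) -E dvdn_mulr.
have Et : r ^ 2 + (p + 2) * u ^ 2 = k * t ^ 2.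
  apply/eqP; rewrite -(eqn_pmul2l (_ : 0 < s ^ 2)) ?expn_gt0 ?s_gt0 // E Es.
  by apply/eqP; ring.
have : k %| 2.
  have ku : k %| 2 * u ^ 2.
    rewrite -(dvdn_addr (m := r ^ 2 + p * u ^ 2)) ?Es ?dvdn_mulr //.
    by rewrite -Es -addnA -mulnDl Et dvdn_mulr.
  have kr : k %| 2 * r ^ 2.
    rewrite -(dvdn_addr (m := p * (r ^ 2 + (p + 2) * u ^ 2))).
      have -> : p * (r ^ 2 + (p + 2) * u ^ 2) + 2 * r ^ 2 =
                (p + 2) * (r ^ 2 + p * u ^ 2) by ring.
      by rewrite Es mulnCA dvdn_mulr.
    by rewrite Et mulnCA dvdn_mulr.
  have /eqP cru2 : coprime (r ^ 2) (u ^ 2) by rewrite coprimeXl ?coprimeXr.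
  have -> : 2 = gcdn (2 * r ^ 2) (2 * u ^ 2) by rewrite -muln_gcdr cru2.
  by rewrite dvdn_gcd kr ku.
rewrite dvdn_divisors // inE => /orP[/eqP k1|].
  exists r, s, t, u; split=> //; rewrite ?Es ?Et ?k1 ?mul1n //.
  by rewrite u_gt0 leq_pmull.
rewrite inE => /eqP k2; case: (double_square_mod8 (s := s) p5 cru).
by rewrite Es k2 mulnC.
Qed.

Lemma no_homogeneous_solution (p x z w y : nat) :
  prime p -> prime (p + 2) -> p %% 8 = 5 -> 0 < y -> coprime w y ->
  x ^ 2 = w ^ 2 + p * y ^ 2 -> z ^ 2 <> w ^ 2 + (p + 2) * y ^ 2.
Proof.
move=> pr_p pr_q p5; elim/ltn_ind: y x z w => y IH x z w y_gt0 cwy Ex Ez.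
have [/dvdnP[i Ey] odd_w odd_x odd_z] := homogeneous_parity p5 cwy Ex Ez.
have [v Ev] : exists v, v = 2 * i by exists (2 * i).
have {}Ey : y = 2 * v by lia.
have cwv : coprime w v by move: cwy; rewrite Ey coprimeMr => /andP[].
have v_gt0 : 0 < v by lia.
rewrite Ey in Ex Ez.
have [a [b [vab cab Eab]]] := pell_factor pr_p odd_w odd_x cwv v_gt0 Ex.
have [c [d [vcd ccd Ecd]]] := pell_factor pr_q odd_w odd_z cwv v_gt0 Ez.
have abcd : a * b = c * d by rewrite -vab.
have even_ab : ~~ odd (a * b) by rewrite -vab Ev oddM.
have opposite := opposite_signs_mod8 p5 cab ccd abcd even_ab.
(* Of the four combinations of signs, the two mixed ones add up to the equation
   excluded by [opposite]; the other two give [same] by subtraction. *)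
have same : a ^ 2 + (p + 2) * d ^ 2 = c ^ 2 + p * b ^ 2.
  by clear - Eab Ecd opposite; case: Eab; case: Ecd; lia.
have /andP[a_gt0 b_gt0] : (0 < a) && (0 < b) by rewrite -muln_gt0 -vab.
have /andP[c_gt0 _] : (0 < c) && (0 < d) by rewrite -muln_gt0 -vcd.
have [r [s [t [u [/andP[u_gt0 leub] cru Es Et]]]]] :=
  same_sign_descent p5 a_gt0 b_gt0 c_gt0 cab abcd same.
apply: (IH u) Es Et => //; apply: leq_ltn_trans leub _.
rewrite Ey; apply: (@leq_ltn_trans v); last by rewrite ltn_Pmull.
by rewrite vab leq_pmull.
Qed.

Local Open Scope ring_scope.

Theorem theorem4 (p q : nat) (hp : prime p) (hq : prime q)
    (hpq : q%:Z - p%:Z = 2) :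
  ((p = 5 %[mod 8])%N ->
     forall sigma : int, sigma = 1 \/ sigma = -1 ->
       ~ has_nontrivial_solution p q sigma) /\
  ((p = 3 %[mod 8])%N \/ (p = 5 %[mod 8])%N ->
     ~ has_nontrivial_solution p q (-1)).
Proof.
have Eq : q = (p + 2)%N by lia.
have absz_sqr (x : int) : x ^+ 2 = (`|x| ^ 2)%N by rewrite -!abszX abszE ger0_norm ?sqr_ge0.
have neg : (p = 3 %[mod 8])%N \/ (p = 5 %[mod 8])%N ->
    ~ has_nontrivial_solution p q (-1).
  move=> p35 [x [y [z [[]]]]]; rewrite !absz_sqr => Ex Ez _.
  case: p35 => pE.
    apply: (@no_negative_pell p `|x| `|y|); first by lia.
    by move: Ex; lia.
  apply: (@no_negative_pell q `|z| `|y|); first by lia.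
  by move: Ez; lia.
split=> // p5 sigma [->|->]; last by apply: neg; right.
move=> [x [y [z [[]]]]]; rewrite !absz_sqr => Ex Ez y0.
apply: (@no_homogeneous_solution p `|x| `|z| 1 `|y|) => //; try lia.
- by rewrite -Eq.
- by rewrite coprime1n.
Qed.
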